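(* Let $\rho$ be a left-linear constrained rewrite rule and let $\Pi X.\,s\,[\exists\vec{x}.\varphi]$ and $\Pi Y.\,t\,[\exists\vec{y}.\psi]$ be satisfiable, pattern-general existentially constrained terms. If $\Pi X.s[\exists\vec{x}.\varphi]\to_\rho\Pi X'.s'[\exists\vec{x}'.\varphi']$ and $\Pi X.s[\exists\vec{x}.\varphi]\sim\Pi Y.t[\exists\vec{y}.\psi]$, then there is an existentially constrained term $\Pi Y'.t'[\exists\vec{y}'.\psi']$ such that $\Pi Y.t[\exists\vec{y}.\psi]\to_\rho\Pi Y'.t'[\exists\vec{y}'.\psi']$ and $\Pi X'.s'[\exists\vec{x}'.\varphi']\sim\Pi Y'.t'[\exists\vec{y}'.\psi']$.
   Context: Fix a many-sorted signature whose sorts are partitioned into theory sorts and term sorts and whose function symbols are partitioned into theory symbols (all argument and result sorts are theory sorts) and term symbols; there is a theory sort $\mathsf{Bool}$. $\mathrm{Var}(t_1,\dots,t_n)$ is the set of variables in the $t_i$; $\mathrm{Pos}(s)$, $s|_p$, $s[u]_p$ as usual. A fixed model $\mathcal{M}$ interprets theory sorts by nonempty sets and theory symbols by functions, with $\mathsf{Bool}=\{\mathsf{true},\mathsf{false}\}$ and standard connectives and equalities; every element of every interpreted sort is a constant theory symbol, called a value; $\mathrm{Val}$ is the set of values and $\mathrm{Val}(s)$ the set of values occurring in $s$. A logical constraint is a $\mathsf{Bool}$-sorted term of theory symbols and variables; $\models_{\mathcal{M},\xi}\varphi$ (valuation $\xi$) and $\models_{\mathcal{M}}\varphi$ (all valuations)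 as usual. Substitutions are sort-preserving, $\mathrm{Dom}(\sigma)=\{x\mid\sigma(x)\ne x\}$, $\sigma$ is $X$-valued if $\sigma(X)\subseteq\mathrm{Val}$. Existential constraint $\exists\vec x.\varphi$: $\{\vec x\}\subseteq\mathrm{Var}(\varphi)$, $\mathrm{FVar}=\mathrm{Var}(\varphi)\setminus\{\vec x\}$; $\models_{\mathcal{M},\xi}\exists\vec x.\varphi$ iff some values $\vec v$ give $\models_{\mathcal{M},\xi}\varphi\{\vec x\mapsto\vec v\}$; valid/satisfiable: for all/some $\xi$. $\sigma\models_{\mathcal{M}}\exists\vec x.\varphi$ means $\sigma(\mathrm{FVar}(\exists\vec x.\varphi))\subseteq\mathrm{Val}$ and $\models_{\mathcal{M}}(\exists\vec x.\varphi)\sigma$. An existentially constrained term $\Pi X.s[\exists\vec x.\varphi]$ requires $\mathrm{FVar}(\exists\vec x.\varphi)\subseteq X\subseteq\mathrm{Var}(s)$ and $\{\vec x\}\cap\mathrm{Var}(s)=\emptyset$; satisfiable if its constraint is; pattern-general if every variable of $X$ occurs at most once in $s$ and $\mathrm{Val}(s)=\emptyset$. Equivalence: $\Pi X.s[\exists\vec x.\varphi]\sim\Pi Y.t[\exists\vec y.\psi]$ iff for every $X$-valued $\sigma$ with $\sigma\models_{\mathcal{M}}\exists\vec x.\varphi$ there is a $Y$-valued $\gamma$ with $\gamma\models_{\mathcal{M}}\exists\vec y.\psi$ and $s\sigma=t\gamma$, and vice versa. A constrained rewrite rule $\rho:\Pi Z.\ell\to r[\pi]$: $\ell,r$ terms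 of the same sort, $\pi$ a logical constraint, $(\mathrm{Var}(r)\setminus\mathrm{Var}(\ell))\cup\mathrm{Var}(\pi)\subseteq Z\subseteq\mathrm{Var}(\ell,r,\pi)=\mathrm{Var}(\rho)$; left-linear if $\ell$ is linear; $\mathrm{ExVar}(\rho)=\mathrm{Var}(r)\setminus\mathrm{Var}(\ell)$. Most general rewrite step: for satisfiable $\Pi X.s[\exists\vec x.\varphi]$ and left-linear $\rho$ with $\mathrm{Var}(\rho)\cap\mathrm{Var}(s,\varphi)=\emptyset$, if $p\in\mathrm{Pos}(s)$ and $\gamma$ satisfy $\mathrm{Dom}(\gamma)=\mathrm{Var}(\ell)$, $s|_p=\ell\gamma$, $\gamma(x)\in\mathrm{Val}\cup X$ for all $x\in\mathrm{Var}(\ell)\cap Z$, and $\models_{\mathcal{M}}(\exists\vec x.\varphi)\Rightarrow(\exists\vec z.\pi\gamma)$ with $\{\vec z\}=\mathrm{Var}(\pi)\setminus\mathrm{Var}(\ell)$, then $\Pi X.s[\exists\vec x.\varphi]\to_\rho\Pi Y.t[\exists\vec y.\psi]$ with $t=s[r\gamma]_p$, $\psi=\varphi\land\pi\gamma$, $\{\vec y\}=\mathrm{Var}(\psi)\setminus\mathrm{Var}(t)$, $Y=\mathrm{ExVar}(\rho)\cup(X\cap\mathrm{Var}(t))$. Convention: rules are used with variables renamed apart, i.e. the variables of $\rho$ are assumed (after renaming $\rho$ if necessary) disjoint from those of every term it is applied to.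
   Formalization: In every existentially constrained term (including the results of steps) the variables in X are required to be of theory sort; otherwise no X-valued substitution exists, equivalence is vacuous, and the claim fails, e.g. f(x) ~ g(y) with the rule f(z) → z. *)

(* Defs.v *)
From mathcomp Require Import all_boot.

Set Implicit Arguments.
Unset Strict Implicit.
Unset Printing Implicit Defensive.

(* Finite sets of variables are represented by sequences, compared by membership
   ([=i], [{subset _ <= _}]). *)

Record signature := Signature {
  sort : eqType;
  theory_sort : pred sort;
  bool_sort : sort;
  fsym : eqType;
  arity : fsym -> seq sort;
  res : fsym -> sort;
  theory_sym : pred fsym;
  var : eqType;
  vsort : var -> sort;
  not_sym : fsym;
  and_sym : fsym;
  or_sym : fsym;
  imp_sym : fsym;
  eq_sym : sort -> fsym;
  bool_sort_theory : theory_sort bool_sort;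
  theory_symP : forall f, theory_sym f -> all theory_sort (res f :: arity f);
  not_symP : [/\ theory_sym not_sym, arity not_sym = [:: bool_sort]
               & res not_sym = bool_sort];
  and_symP : [/\ theory_sym and_sym, arity and_sym = [:: bool_sort; bool_sort]
               & res and_sym = bool_sort];
  or_symP : [/\ theory_sym or_sym, arity or_sym = [:: bool_sort; bool_sort]
              & res or_sym = bool_sort];
  imp_symP : [/\ theory_sym imp_sym, arity imp_sym = [:: bool_sort; bool_sort]
               & res imp_sym = bool_sort];
  eq_symP : forall a, theory_sort a ->
    [/\ theory_sym (eq_sym a), arity (eq_sym a) = [:: a; a]
      & res (eq_sym a) = bool_sort]
}.

(* Elements of the interpreted sorts are themselves constant theory symbols, so
   the carrier of a theory sort [a] is the set of [v] with [value v] and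
   [res v = a].  Accordingly [interp f] acts on sequences of symbols; it is only
   meaningful for a theory symbol [f] applied to values of the right sorts. *)
Record model (Sg : signature) := Model {
  value : pred (fsym Sg);
  interp : fsym Sg -> seq (fsym Sg) -> fsym Sg;
  bval : bool -> fsym Sg;
  valueP : forall v, value v -> theory_sym v /\ arity v = [::];
  carrier_nonempty : forall a : sort Sg, theory_sort a ->
    exists v, value v /\ res v = a;
  interp_sort : forall f vs, theory_sym f -> all value vs ->
    map (@res Sg) vs = arity f ->
    value (interp f vs) /\ res (interp f vs) = res f;
  interp_value : forall v, value v -> interp v [::] = v;
  bval_value : forall b, value (bval b) /\ res (bval b) = bool_sort Sg;
  bval_inj : injective bval;
  bval_surj : forall v, value v -> res v = bool_sort Sg -> exists b, v = bval b;
  interp_not : forall b, interp (not_sym Sg) [:: bval b] = bval (~~ b);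
  interp_and : forall b c,
    interp (and_sym Sg) [:: bval b; bval c] = bval (b && c);
  interp_or : forall b c,
    interp (or_sym Sg) [:: bval b; bval c] = bval (b || c);
  interp_imp : forall b c,
    interp (imp_sym Sg) [:: bval b; bval c] = bval (b ==> c);
  interp_eq : forall (a : sort Sg) v w, theory_sort a ->
    value v -> res v = a -> value w -> res w = a ->
    interp (eq_sym a) [:: v; w] = bval (v == w)
}.

(* Raw terms; the actual terms are those satisfying [well_sorted]. *)
Inductive term (Sg : signature) :=
  | Var of var Sg
  | App of fsym Sg & seq (term Sg).

Definition tsort (Sg : signature) (t : term Sg) : sort Sg :=
  match t with Var x => vsort x | App f _ => res f end.

Fixpoint well_sorted (Sg : signature) (t : term Sg) : bool :=
  match t with
  | Var _ => true
  | App f ts => (map (@tsort Sg) ts == arity f) && all (@well_sorted Sg) ts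
  end.

(* With multiplicity, from left to right. *)
Fixpoint vars (Sg : signature) (t : term Sg) : seq (var Sg) :=
  match t with
  | Var x => [:: x]
  | App _ ts => flatten (map (@vars Sg) ts)
  end.

Definition linear (Sg : signature) (t : term Sg) : bool := uniq (vars t).

Fixpoint syms (Sg : signature) (t : term Sg) : seq (fsym Sg) :=
  match t with
  | Var _ => [::]
  | App f ts => f :: flatten (map (@syms Sg) ts)
  end.

Definition vals (Sg : signature) (M : model Sg) (t : term Sg) : seq (fsym Sg) :=
  [seq f <- syms t | value M f].

Definition is_val (Sg : signature) (M : model Sg) (t : term Sg) : Prop :=
  exists2 v, value M v & t = App v [::].

(* [subterm_at s p] is [None] when [p] is not a position of [s]. *)
Fixpoint subterm_at (Sg : signature) (s : term Sg) (p : seq nat) :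
    option (term Sg) :=
  match p, s with
  | [::], _ => Some s
  | i :: q, App _ ts => obind (fun u => subterm_at u q) (onth ts i)
  | _ :: _, Var _ => None
  end.

Fixpoint replace_at (Sg : signature) (s : term Sg) (p : seq nat) (u : term Sg) :
    term Sg :=
  match p, s with
  | [::], _ => u
  | i :: q, App f ts =>
      App f (if onth ts i is Some w then set_nth w ts i (replace_at w q u)
             else ts)
  | _ :: _, Var _ => s
  end.

Record subst (Sg : signature) := Subst {
  subst_fun :> var Sg -> term Sg;
  substP : forall x,
    well_sorted (subst_fun x) /\ tsort (subst_fun x) = vsort x
}.

Fixpoint tsubst (Sg : signature) (sg : var Sg -> term Sg) (t : term Sg) :
    term Sg :=
  match t with
  | Var x => sg x
  | App f ts => App f (map (tsubst sg) ts)
  end.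

Definition in_dom (Sg : signature) (sg : subst Sg) (x : var Sg) : Prop :=
  sg x <> Var x.

Definition valued (Sg : signature) (M : model Sg) (X : seq (var Sg))
    (sg : subst Sg) : Prop :=
  forall x, x \in X -> is_val M (sg x).

(* Only the values at variables of theory sort matter. *)
Record valuation (Sg : signature) (M : model Sg) := Valuation {
  val_fun :> var Sg -> fsym Sg;
  val_funP : forall x, theory_sort (vsort x) ->
    value M (val_fun x) /\ res (val_fun x) = vsort x
}.

Fixpoint eval (Sg : signature) (M : model Sg) (xi : valuation M) (t : term Sg) :
    fsym Sg :=
  match t with
  | Var x => xi x
  | App f ts => interp M f (map (eval xi) ts)
  end.

Definition logical_constraint (Sg : signature) (phi : term Sg) : Prop :=
  [/\ well_sorted phi, tsort phi = bool_sort Sg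
    & all (@theory_sym Sg) (syms phi)].

Definition holds (Sg : signature) (M : model Sg) (xi : valuation M)
    (phi : term Sg) : Prop :=
  eval xi phi = bval M true.

Definition and_term (Sg : signature) (phi psi : term Sg) : term Sg :=
  App (and_sym Sg) [:: phi; psi].

Definition vdiff (V : eqType) (A B : seq V) : seq V :=
  [seq x <- A | x \notin B].

Definition vdisjoint (V : eqType) (A B : seq V) : Prop :=
  forall x, x \in A -> x \notin B.

(* The constraint "exists bv, body"; that [bv] occurs in [body] and that [body]
   is a logical constraint is required in [ecterm]. *)
Record exconstr (Sg : signature) := Ex {
  bvars : seq (var Sg);
  body : term Sg
}.

Definition fvars (Sg : signature) (C : exconstr Sg) : seq (var Sg) :=
  vdiff (vars (body C)) (bvars C).

(* [sg] is the substitution sending the bound variables to the witnesses. *)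
Definition ex_holds (Sg : signature) (M : model Sg) (xi : valuation M)
    (C : exconstr Sg) : Prop :=
  exists sg : subst Sg,
    [/\ valued M (bvars C) sg,
        forall x, x \notin bvars C -> sg x = Var x
      & holds xi (tsubst sg (body C))].

Definition ex_valid (Sg : signature) (M : model Sg) (C : exconstr Sg) : Prop :=
  forall xi : valuation M, ex_holds xi C.

Definition ex_satisfiable (Sg : signature) (M : model Sg) (C : exconstr Sg) :
    Prop :=
  exists xi : valuation M, ex_holds xi C.

(* Bound variables are left untouched.  Capture is not an issue: this is only
   applied to substitutions mapping the free variables of [C] to values. *)
Definition ex_subst (Sg : signature) (sg : subst Sg) (C : exconstr Sg) :
    exconstr Sg :=
  Ex (bvars C)
     (tsubst (fun x => if x \in bvars C then Var x else sg x) (body C)).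

Definition subst_models (Sg : signature) (M : model Sg) (sg : subst Sg)
    (C : exconstr Sg) : Prop :=
  valued M (fvars C) sg /\ ex_valid M (ex_subst sg C).

(* The variables in [ec_X] are those to be instantiated by values; they are
   required to be of theory sort, as no sort-preserving substitution could be
   [ec_X]-valued otherwise. *)
Record ecterm (Sg : signature) := ECTerm {
  ec_X : seq (var Sg);
  ec_term : term Sg;
  ec_constr : exconstr Sg;
  ec_term_sorted : well_sorted ec_term;
  ec_constr_logical : logical_constraint (body ec_constr);
  ec_bvars_sub : {subset bvars ec_constr <= vars (body ec_constr)};
  ec_X_theory : forall x, x \in ec_X -> theory_sort (vsort x);
  ec_fvars_sub : {subset fvars ec_constr <= ec_X};
  ec_X_sub : {subset ec_X <= vars ec_term};
  ec_bvars_disj : vdisjoint (bvars ec_constr) (vars ec_term)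
}.

Definition satisfiable (Sg : signature) (M : model Sg) (S : ecterm Sg) : Prop :=
  ex_satisfiable M (ec_constr S).

Definition pattern_general (Sg : signature) (M : model Sg) (S : ecterm Sg) :
    Prop :=
  (forall x, x \in ec_X S -> count_mem x (vars (ec_term S)) <= 1)
  /\ vals M (ec_term S) = [::].

Definition subsumed (Sg : signature) (M : model Sg) (S T : ecterm Sg) : Prop :=
  forall sg : subst Sg,
    valued M (ec_X S) sg -> subst_models M sg (ec_constr S) ->
    exists ga : subst Sg,
      [/\ valued M (ec_X T) ga, subst_models M ga (ec_constr T)
        & tsubst sg (ec_term S) = tsubst ga (ec_term T)].

Definition equivalent (Sg : signature) (M : model Sg) (S T : ecterm Sg) : Prop :=
  subsumed M S T /\ subsumed M T S.

Record crule (Sg : signature) := CRule {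
  rule_Z : seq (var Sg);
  lhs : term Sg;
  rhs : term Sg;
  guard : term Sg;
  lhs_sorted : well_sorted lhs;
  rhs_sorted : well_sorted rhs;
  rule_sort : tsort lhs = tsort rhs;
  guard_logical : logical_constraint guard;
  rule_Z_sup : {subset vdiff (vars rhs) (vars lhs) ++ vars guard <= rule_Z};
  rule_Z_sub : {subset rule_Z <= vars lhs ++ vars rhs ++ vars guard}
}.

Definition rule_vars (Sg : signature) (rho : crule Sg) : seq (var Sg) :=
  vars (lhs rho) ++ vars (rhs rho) ++ vars (guard rho).

Definition rule_exvars (Sg : signature) (rho : crule Sg) : seq (var Sg) :=
  vdiff (vars (rhs rho)) (vars (lhs rho)).

Definition left_linear (Sg : signature) (rho : crule Sg) : bool :=
  linear (lhs rho).

Definition renamed_apart (Sg : signature) (rho : crule Sg) (S : ecterm Sg) :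
    Prop :=
  vdisjoint (rule_vars rho) (vars (ec_term S) ++ vars (body (ec_constr S))).

Definition step_redex (Sg : signature) (M : model Sg) (rho : crule Sg)
    (S : ecterm Sg) (p : seq nat) (ga : subst Sg) : Prop :=
  [/\ forall x, in_dom ga x <-> x \in vars (lhs rho),
      subterm_at (ec_term S) p = Some (tsubst ga (lhs rho)),
      forall x, x \in vars (lhs rho) -> x \in rule_Z rho ->
        is_val M (ga x) \/ exists2 y, y \in ec_X S & ga x = Var y
    & forall xi : valuation M, ex_holds xi (ec_constr S) ->
        ex_holds xi (Ex (vdiff (vars (guard rho)) (vars (lhs rho)))
                        (tsubst ga (guard rho)))].

Definition step_result (Sg : signature) (rho : crule Sg) (S : ecterm Sg)
    (p : seq nat) (ga : subst Sg) (T : ecterm Sg) : Prop :=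
  [/\ ec_term T = replace_at (ec_term S) p (tsubst ga (rhs rho)),
      body (ec_constr T)
        = and_term (body (ec_constr S)) (tsubst ga (guard rho)),
      bvars (ec_constr T) =i vdiff (vars (body (ec_constr T))) (vars (ec_term T))
    & ec_X T =i rule_exvars rho
                ++ [seq x <- ec_X S | x \in vars (ec_term T)]].

Definition most_general_step (Sg : signature) (M : model Sg) (rho : crule Sg)
    (S T : ecterm Sg) : Prop :=
  [/\ satisfiable M S, left_linear rho, renamed_apart rho S
    & exists p ga, step_redex M rho S p ga /\ step_result rho S p ga T].

(* Main.v *)
(** Instantiating the variables of [X] by values and fixing all others, the two
    inclusions of the equivalence force [s] and [t] to have the same positions and
    the same function symbols, since pattern-generality excludes values from both.
    As variables of [X] occur only once in [s], [t] is then the image of [s] under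
    a sort-preserving bijective renaming [d] that sends [X] to [Y] and the
    solutions of one constraint to those of the other.  The redex [ga] of [s] is
    carried to the redex [d o ga] of [t] at the same position, and the two reducts
    are again related by [d]. *)

Require Import Defs.
From mathcomp Require Import all_boot.

Set Implicit Arguments.
Unset Strict Implicit.
Unset Printing Implicit Defensive.

(** * Terms: substitution, positions and replacement *)

Section Terms.
Variable Sg : signature.
Implicit Types (s t u : term Sg) (f g : var Sg -> term Sg) (x y : var Sg).

Fixpoint all_terms (P : term Sg -> Prop) (ts : seq (term Sg)) : Prop :=
  if ts is t :: ts' then P t /\ all_terms P ts' else True.

(** Arguments of [App] sit inside a list, so the generated induction principle gives no hypothesis
    for them; the nested recursion over the list supplies it. *)
Lemma term_nested_ind (P : term Sg -> Prop) :
  (forall x, P (Var x)) -> (forall h ts, all_terms P ts -> P (App h ts)) ->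
  forall t, P t.
Proof.
move=> PV PA; fix IH 1; case=> [x|h ts]; first exact: PV.
apply: PA; elim: ts => [|t ts IHts]; [exact: I|by split; [exact: IH|exact: IHts]].
Qed.

Lemma tsort_tsubst (sg : subst Sg) t : tsort (tsubst sg t) = tsort t.
Proof. by case: t => //= x; case: (substP sg x). Qed.

Lemma well_sorted_tsubst (sg : subst Sg) t :
  well_sorted t -> well_sorted (tsubst sg t).
Proof.
elim/term_nested_ind: t => [x _|h ts IH] /=; first by case: (substP sg x).
case/andP=> /eqP <- ws; rewrite -map_comp; apply/andP; split.
  by apply/eqP/eq_map => t /=; rewrite tsort_tsubst.
by elim: ts IH ws => //= t ts IHts [IHt /IHts{}IHts] /andP[/IHt -> /IHts].
Qed.

Lemma vars_tsubst f t : vars (tsubst f t) = flatten [seq vars (f x) | x <- vars t].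
Proof.
elim/term_nested_ind: t => [x|h ts IH] /=; first by rewrite cats0.
elim: ts IH => //= t ts IHts [-> /IHts ->].
by rewrite map_cat flatten_cat.
Qed.

Lemma in_vars_tsubst f t y :
  reflect (exists2 x, x \in vars t & y \in vars (f x)) (y \in vars (tsubst f t)).
Proof. by rewrite vars_tsubst; apply: flatten_mapP. Qed.

Lemma tsubst_comp f g t :
  tsubst f (tsubst g t) = tsubst (fun x => tsubst f (g x)) t.
Proof.
elim/term_nested_ind: t => //= h ts IH; congr App.
by elim: ts IH => //= t ts IHts [-> /IHts ->].
Qed.

Lemma eq_in_tsubst f g t : {in vars t, f =1 g} -> tsubst f t = tsubst g t.
Proof.
elim/term_nested_ind: t => [x|h ts IH] /= fg.
  by apply: fg; rewrite inE.
congr App; elim: ts IH fg => //= t ts IHts [IHt /IHts{}IHts] fg.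
congr cons; [apply: IHt|apply: IHts] => x xt; apply: fg;
  by rewrite mem_cat xt ?orbT.
Qed.

Lemma tsubst_inj_in f g t : tsubst f t = tsubst g t -> {in vars t, f =1 g}.
Proof.
elim/term_nested_ind: t => [x|h ts IH] /=; first by move=> fg y /[!inE] /eqP ->.
case=> E; elim: ts IH E => //= t ts IHts [IHt /IHts{}IHts] [/IHt{}IHt /IHts{}IHts].
by move=> x; rewrite mem_cat => /orP[/IHt|/IHts].
Qed.

Lemma tsubst_id t : tsubst (@Var Sg) t = t.
Proof.
elim/term_nested_ind: t => //= h ts IH; congr App.
by elim: ts IH => //= t ts IHts [-> /IHts ->].
Qed.


Lemma subterm_at_tsubst f s p u :
  subterm_at s p = Some u -> subterm_at (tsubst f s) p = Some (tsubst f u).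
Proof.
elim: p s => [|i p IH] [x|h ts] //=; try by case=> <-.
by rewrite onth_map; case: (onth ts i) => //= w /IH.
Qed.

(** That [p] is a position of [s] matters: below a variable of [s] the replacement does nothing,
    while the substitution could create the position. *)
Lemma replace_at_tsubst f s p u w :
  subterm_at s p = Some w ->
  tsubst f (replace_at s p u) = replace_at (tsubst f s) p (tsubst f u).
Proof.
elim: p s => [|i p IH] [x|h ts] //=.
rewrite onth_map; case E: (onth ts i) => [v|] //= /IH {}IH; congr App.
rewrite -IH; elim: ts i {IH} E => [|t ts IHts] [|i] //= E.
by congr cons; elim: ts i E {IHts} => [|t' ts IHts] [|i] //= /IHts ->.
Qed.

Lemma mem_flatten_onth (V : eqType) (h : term Sg -> seq V) ts i u (a : V) :
  onth ts i = Some u -> a \in h u -> a \in flatten (map h ts).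
Proof.
elim: ts i => [|t ts IH] [|i] //=; rewrite mem_cat; first by case=> -> ->.
by move=> /IH{}IH /IH ->; rewrite orbT.
Qed.

Lemma vars_subterm_at s p u :
  subterm_at s p = Some u -> {subset vars u <= vars s}.
Proof.
elim: p s => [|i p IH] [x|h ts] //=; try by case=> <-.
case E: (onth ts i) => [v|] //= /IH{}IH x /IH; exact: mem_flatten_onth E.
Qed.

Lemma flatten_vars_set_nth ts i u v :
  onth ts i = Some v ->
  {subset flatten (map (@vars Sg) (set_nth v ts i u))
     <= flatten (map (@vars Sg) ts) ++ vars u}.
Proof.
move=> E x; rewrite mem_cat.
elim: ts i E => [|t ts IH] [|i] //=; rewrite !mem_cat.
  by move=> _ /orP[->|->]; rewrite !orbT.
by move=> /IH{}IH /orP[->|/IH/orP[->|->]]; rewrite ?orbT.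
Qed.

Lemma vars_replace_at s p u :
  {subset vars (replace_at s p u) <= vars s ++ vars u}.
Proof.
elim: p s => [|i p IH] [x|h ts] y /=;
  try by rewrite ?mem_cat ?inE => ->; rewrite ?orbT.
case E: (onth ts i) => [v|] /=; last by rewrite mem_cat => ->.
move=> /(flatten_vars_set_nth E); rewrite !mem_cat => /orP[-> //|/IH].
by rewrite mem_cat => /orP[/(mem_flatten_onth E) -> //|->]; rewrite orbT.
Qed.

Lemma vars_replace_at_sub s p u w :
  subterm_at s p = Some w -> {subset vars u <= vars (replace_at s p u)}.
Proof.
elim: p s => [|i p IH] [x|h ts] /=; try by move=> E y.
case E: (onth ts i) => [v|] //= /IH{}IH x /IH.
apply: (@mem_flatten_onth _ (@vars Sg) _ i).
by elim: ts i {IH} E => [|t ts IHts] [|i] //= /IHts.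
Qed.

Lemma tsort_replace_at s p u w :
  subterm_at s p = Some w -> tsort u = tsort w -> tsort (replace_at s p u) = tsort s.
Proof. by case: p s => [|i p] [x|h ts] //= [<-]. Qed.

Lemma well_sorted_replace_at s p u w :
  subterm_at s p = Some w -> tsort u = tsort w -> well_sorted u ->
  well_sorted s -> well_sorted (replace_at s p u).
Proof.
move=> + su wu; elim: p s => [|i p IH] [x|h ts] //=.
case E: (onth ts i) => [v|] //= wv.
have sv := tsort_replace_at wv su; move/IH: wv => {}IH /andP[/eqP <- ws].
apply/andP; split.
  apply/eqP; elim: ts i E {ws} => [|t ts IHts] [|i] //=; first by case=> ->; rewrite sv.
  by move=> /IHts ->.
elim: ts i E ws => [|t ts IHts] [|i] //=; first by case=> -> /andP[/IH -> ->].
by move=> /IHts{}IHts /andP[-> /IHts].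
Qed.

End Terms.

(** * Valuations, constraints and value substitutions *)

Section Semantics.
Variables (Sg : signature) (M : model Sg).
Implicit Types (xi : valuation M) (x y : var Sg) (t : term Sg) (C : exconstr Sg)
  (S T : ecterm Sg) (A : seq (var Sg)) (sg : subst Sg).

(** Two valuations and two substitutions at once: together with [tsubst_id] this serves both as the
    substitution lemma and as the coincidence lemma. *)
Lemma eval_tsubst xi xi' (f g : var Sg -> term Sg) t :
  {in vars t, forall x, eval xi (f x) = eval xi' (g x)} ->
  eval xi (tsubst f t) = eval xi' (tsubst g t).
Proof.
elim/term_nested_ind: t => [x|h ts IH] /= fg; first by apply: fg; rewrite inE.
congr interp; elim: ts IH fg => //= t ts IHts [IHt /IHts{}IHts] fg.
congr cons; [apply: IHt|apply: IHts] => x xt; apply: fg;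
  by rewrite mem_cat xt ?orbT.
Qed.

(** Such a variable is either the constraint itself, of sort Bool, or an argument of a theory
    symbol. *)
Lemma logical_vars_theory (phi : term Sg) x :
  logical_constraint phi -> x \in vars phi -> theory_sort (vsort x).
Proof.
(* The sort Bool is weakened to an arbitrary theory sort, since subterms of a constraint need not be
   Boolean. *)
case=> ws srt th; have {srt} : theory_sort (tsort phi).
  by rewrite srt bool_sort_theory.
elim/term_nested_ind: phi ws th => [y|h ts IH] /=; first by rewrite inE => _ _ ? /eqP->.
case/andP=> /eqP ar ws /andP[/theory_symP /= /andP[_]]; rewrite -ar.
elim: ts IH ws {ar} => //= t ts IHts [IHt /IHts{}IHts] /andP[wt /IHts{}IHts].
case/andP=> st /IHts{}IHts; rewrite all_cat mem_cat => /andP[tt /IHts{}IHts] sh.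
by case/orP=> [|/(IHts sh)//]; apply: IHt.
Qed.

Lemma bvars_theory S : {in bvars (ec_constr S), forall x, theory_sort (vsort x)}.
Proof.
move=> x /ec_bvars_sub; exact: logical_vars_theory (ec_constr_logical S).
Qed.

Lemma valuation_is_val xi x : theory_sort (vsort x) -> is_val M (App (xi x) [::]).
Proof. by case/(val_funP xi) => ? _; exists (xi x). Qed.

Definition splice_fun A xi xi' x := if x \in A then xi' x else xi x.

Lemma splice_funP A xi xi' x : theory_sort (vsort x) ->
  value M (splice_fun A xi xi' x) /\ res (splice_fun A xi xi' x) = vsort x.
Proof. by rewrite /splice_fun; case: ifP => _; apply: val_funP. Qed.

Definition splice A xi xi' : valuation M := Valuation (@splice_funP A xi xi').

Lemma splice_in A xi xi' x : x \in A -> splice A xi xi' x = xi' x.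
Proof. by rewrite /= /splice_fun => ->. Qed.

Lemma splice_out A xi xi' x : x \notin A -> splice A xi xi' x = xi x.
Proof. by rewrite /= /splice_fun => /negPf ->. Qed.

(* Images under [sg] that are not values are ignored. *)
Definition assign_fun A xi (sg : subst Sg) x :=
  if x \in A then
    if sg x is App h [::] then if value M h then h else xi x else xi x
  else xi x.

Lemma assign_funP A xi (sg : subst Sg) x : theory_sort (vsort x) ->
  value M (assign_fun A xi sg x) /\ res (assign_fun A xi sg x) = vsort x.
Proof.
move/(val_funP xi) => xiP; rewrite /assign_fun; case: ifP => // _.
case: (sg x) (substP sg x) => // h [|//] [_ /= sh].
by case: ifP.
Qed.

Definition assign A xi sg : valuation M := Valuation (@assign_funP A xi sg).

Lemma assign_in A xi sg x :
  x \in A -> is_val M (sg x) -> sg x = App (assign A xi sg x) [::].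
Proof. by rewrite /= /assign_fun => -> [v vv ->]; rewrite vv. Qed.

Lemma assign_out A xi sg x : x \notin A -> assign A xi sg x = xi x.
Proof. by rewrite /= /assign_fun => /negPf ->. Qed.

(** The test on the sort keeps this sort-preserving: at other sorts a valuation is unconstrained. *)
Definition vsubst_fun A xi x :=
  if (x \in A) && theory_sort (vsort x) then App (xi x) [::] else Var x.

Lemma vsubst_funP A xi x :
  well_sorted (vsubst_fun A xi x) /\ tsort (vsubst_fun A xi x) = vsort x.
Proof.
rewrite /vsubst_fun; case: ifP => //= /andP[_ /(val_funP xi)[/valueP[_ ->]] ->].
by rewrite eqxx.
Qed.

Definition vsubst A xi : subst Sg := Subst (@vsubst_funP A xi).

Lemma vsubst_in A xi x :
  theory_sort (vsort x) -> x \in A -> vsubst A xi x = App (xi x) [::].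
Proof. by rewrite /= /vsubst_fun => -> ->. Qed.

Lemma vsubst_out A xi x : x \notin A -> vsubst A xi x = Var x.
Proof. by rewrite /= /vsubst_fun => /negPf ->. Qed.

(** Trades the witnessing substitution for a valuation changed at the bound variables only. The next
    lemma is the way back. *)
Lemma ex_holds_val xi C : ex_holds xi C ->
  exists2 xi' : valuation M,
    (forall x, x \notin bvars C -> xi' x = xi x) & holds xi' (body C).
Proof.
case=> sg [vsg osg hsg]; exists (assign (bvars C) xi sg).
  by move=> x; apply: assign_out.
rewrite /holds -hsg -[in LHS](tsubst_id (body C)); apply: eval_tsubst => x _.
case: (boolP (x \in bvars C)) => xC; last by rewrite osg //; exact: assign_out.
have Ex := assign_in xi xC (vsg x xC); rewrite Ex.
have vx w : sg x = App w [::] -> value M w.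
  by case: (vsg x xC) => v vv -> [<-].
by symmetry; apply/interp_value/vx.
Qed.

Lemma val_ex_holds xi xi' C :
  {in bvars C, forall x, theory_sort (vsort x)} ->
  {in fvars C, forall x, xi' x = xi x} -> holds xi' (body C) -> ex_holds xi C.
Proof.
move=> thC eqC hC; exists (vsubst (bvars C) xi'); split.
- by move=> x xC; rewrite vsubst_in ?thC //; apply/valuation_is_val/thC.
- by move=> x; apply: vsubst_out.
rewrite /holds -hC -[in RHS](tsubst_id (body C)); apply: eval_tsubst => x xb.
case: (boolP (x \in bvars C)) => xC.
  rewrite vsubst_in ?thC //=; apply: interp_value.
  by case: (val_funP xi' (thC x xC)).
by rewrite vsubst_out //= eqC // mem_filter xC.
Qed.

Lemma ec_X_bvars S x : x \in ec_X S -> x \notin bvars (ec_constr S).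
Proof. by move/ec_X_sub=> xs; apply/negP => /ec_bvars_disj; rewrite xs. Qed.

Lemma vars_body S :
  {subset vars (body (ec_constr S)) <= bvars (ec_constr S) ++ ec_X S}.
Proof.
move=> x xb; rewrite mem_cat; case: (boolP (x \in bvars _)) => //= xC.
by apply: ec_fvars_sub; rewrite mem_filter xC.
Qed.

(* [xi0] only serves to show that some valuation exists. *)
Lemma subst_models_val xi0 S (sg : subst Sg) :
  valued M (ec_X S) sg -> subst_models M sg (ec_constr S) ->
  exists2 xi : valuation M, holds xi (body (ec_constr S))
    & {in ec_X S, forall x, sg x = App (xi x) [::]}.
Proof.
move=> vX [_ /(_ xi0) /ex_holds_val[xi1 _ h1]].
have sgX x : x \in ec_X S -> sg x = App (assign (ec_X S) xi1 sg x) [::].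
  by move=> xX; apply: assign_in => //; apply: vX.
(* On [ec_X S] the values come from [sg]; the bound variables, which lie outside [ec_X S], keep
   their witnesses from [xi1]. *)
exists (assign (ec_X S) xi1 sg) => //.
rewrite /holds -h1 -[in LHS](tsubst_id (body _)); apply: eval_tsubst => x.
move/vars_body; rewrite mem_cat; case: ifP => /= [xC _|_ xX].
  by rewrite -[RHS](assign_out (A := ec_X S) xi1 sg) //; apply: contraL xC; apply: ec_X_bvars.
rewrite sgX //= interp_value //.
by case: (val_funP (assign (ec_X S) xi1 sg) (ec_X_theory xX)).
Qed.

Lemma val_subst_models xi S (sg : subst Sg) :
  holds xi (body (ec_constr S)) ->
  {in ec_X S, forall x, sg x = App (xi x) [::]} ->
  valued M (ec_X S) sg /\ subst_models M sg (ec_constr S).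
Proof.
move=> hxi sgX; have vX : valued M (ec_X S) sg.
  by move=> x xX; rewrite sgX //; apply/valuation_is_val/(ec_X_theory xX).
split=> //; split=> [x /ec_fvars_sub/vX //|xi'].
(* The witnesses for the bound variables are read off [xi], whatever [xi'] is; the free variables
   have already become values. *)
apply: (@val_ex_holds _ (splice (bvars (ec_constr S)) xi' xi)).
- exact: bvars_theory.
- by move=> x; rewrite mem_filter => /andP[xC _]; rewrite splice_out.
rewrite /holds -hxi -[in RHS](tsubst_id (body _)); apply: eval_tsubst => x.
move/vars_body; rewrite mem_cat; case: ifP => /= [xC _|_ xX].
  exact: splice_in.
rewrite sgX //= interp_value //.
by case: (val_funP xi (ec_X_theory xX)).
Qed.

(** Subsumption is tested on the substitution that instantiates [ec_X S] alone. Since all other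
    variables stay in place, the resulting equation retains the structure of [ec_term S]. *)
Lemma subsumed_val S T xi : subsumed M S T -> holds xi (body (ec_constr S)) ->
  exists (xi' : valuation M) (ga : subst Sg),
    [/\ holds xi' (body (ec_constr T)),
        {in ec_X T, forall y, ga y = App (xi' y) [::]}
      & tsubst (vsubst (ec_X S) xi) (ec_term S) = tsubst ga (ec_term T)].
Proof.
move=> sub hxi.
have [|v m] := @val_subst_models xi S (vsubst (ec_X S) xi) hxi.
  by move=> x xX; apply: vsubst_in => //; apply: ec_X_theory xX.
have [ga [vga mga E]] := sub _ v m.
have [xi' h' ga'] := subst_models_val xi vga mga.
by exists xi', ga.
Qed.

End Semantics.

(** * From equivalence to a renaming, and back *)

Section Renaming.
Variables (Sg : signature) (M : model Sg).
Implicit Types (s t : term Sg) (S T : ecterm Sg).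

Fixpoint same_shape s t :=
  match s, t with
  | Var _, Var _ => true
  | App f ss, App g ts => (f == g) && all2 same_shape ss ts
  | _, _ => false
  end.

Lemma same_shape_size s t : same_shape s t -> size (vars s) = size (vars t).
Proof.
elim/term_nested_ind: s t => [x|f ss IH] [y|g ts] //= /andP[_].
elim: ss IH ts => [|s ss IHss] /= => [_|[IHs /IHss{}IHss]] [|t ts] //=.
by case/andP=> /IHs st /IHss sts; rewrite !size_cat st sts.
Qed.

Lemma same_shape_vars s t (f g : var Sg -> term Sg) :
  same_shape s t -> tsubst f s = tsubst g t -> map f (vars s) = map g (vars t).
Proof.
elim/term_nested_ind: s t => [x|h ss IH] [y|h' ts] //=; first by move=> _ ->.
case/andP=> _ + []; move=> + _.
elim: ss IH ts => [|s ss IHss] /= => [_|[IHs /IHss{}IHss]] [|t ts] //=.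
case/andP=> /IHs{}IHs /IHss{}IHss [/IHs{}IHs /IHss{}IHss].
by rewrite !map_cat IHs IHss.
Qed.

Lemma same_shape_tsubst s t (f g : var Sg -> term Sg) :
  same_shape s t -> map f (vars s) = map g (vars t) -> tsubst f s = tsubst g t.
Proof.
elim/term_nested_ind: s t => [x|h ss IH] [y|h' ts] //=; first by move=> _ [].
case/andP=> /eqP <- shs E; congr App; move: shs E.
elim: ss IH ts => [|s ss IHss] /= => [_|[IHs /IHss{}IHss]] [|t ts] //=.
case/andP=> sh /IHss{}IHss; rewrite !map_cat => E.
have sz : size [seq f i | i <- vars s] = size [seq g i | i <- vars t].
  by rewrite !size_map (same_shape_size sh).
(* Both lists of images are cut where the variables of the first argument end; by [sz] this is the
   same place on both sides. *)
have Es := congr1 (take (size [seq g i | i <- vars t])) E.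
have Ess := congr1 (drop (size [seq g i | i <- vars t])) E.
rewrite !take_size_cat // in Es; rewrite !drop_size_cat // in Ess.
by rewrite (IHs _ sh Es) (IHss Ess).
Qed.

(** If a variable of [s] faced an application in [t], its image under [sg] would be a value whose
    symbol heads that application, but [t] contains no value. The second equation excludes the
    opposite mismatch in the same way. *)
Lemma tsubst_same_shape s t (sg ga ga' sg' : var Sg -> term Sg) :
  (forall x, is_val M (sg x) \/ sg x = Var x) ->
  (forall y, is_val M (ga' y) \/ ga' y = Var y) ->
  vals M s = [::] -> vals M t = [::] ->
  tsubst sg s = tsubst ga t -> tsubst ga' t = tsubst sg' s -> same_shape s t.
Proof.
move=> sgP gaP; elim/term_nested_ind: s t => [x|h ss IH] [y|h' ts] //.
- rewrite /vals /= => _ nv E _; case: (sgP x); rewrite /= in E; rewrite E //.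
  by case=> v vv [Eh _]; rewrite Eh vv in nv.
- rewrite /vals /= => nv _ _ E; case: (gaP y); rewrite /= in E; rewrite E //.
  by case=> v vv [Eh _]; rewrite Eh vv in nv.
rewrite /vals /=; case: ifP => // _; case: ifP => // _ + + [Eh +] [_ +].
rewrite Eh eqxx /=; elim: ss IH ts => [|s ss IHss] /= => [_|[IHs /IHss{}IHss]] [|t ts] //=.
rewrite !filter_cat => + + [Es Ess] [Et Ets].
case E1: [seq _ <- syms s | _] => [|//] /= E2.
case E3: [seq _ <- syms t | _] => [|//] /= E4.
by rewrite IHs // IHss.
Qed.

Lemma map_eq_nth (A B C : Type) (f : A -> C) (g : B -> C) a b x y i :
  map f a = map g b -> i < size a -> f (nth x a i) = g (nth y b i).
Proof.
move=> E ia; have sz : size a = size b by rewrite -(size_map f) E size_map.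
by rewrite -(nth_map x (f x)) // E (nth_map y) // -sz.
Qed.

Lemma index_nth_count (V : eqType) (r : seq V) x0 i :
  count_mem (nth x0 r i) r <= 1 -> i < size r -> index (nth x0 r i) r = i.
Proof.
elim: r i => // a r IH [|i] /=; first by rewrite eqxx.
rewrite ltnS; case: eqP => [E|_] c ir.
  have /count_memPn : count_mem (nth x0 r i) r = 0.
    by apply/eqP; rewrite -leqn0 -ltnS.
  by rewrite mem_nth.
by rewrite IH.
Qed.

(** Fixing everything outside [ec_term S] makes [d] fix the variables of a rule renamed apart from
    [S]. Injectivity is not demanded: on the variables of [ec_term S] it comes from a second
    renaming, from [T] to [S]. *)
Definition renames (d : var Sg -> var Sg) S T : Prop :=
  [/\ forall x, vsort (d x) = vsort x,
      forall x, x \notin vars (ec_term S) -> d x = x,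
      tsubst (fun x => Var (d x)) (ec_term S) = ec_term T
    & {in ec_X S, forall x, d x \in ec_X T}].

Lemma equivalent_renaming S T :
  satisfiable M S -> pattern_general M S ->
  satisfiable M T -> pattern_general M T -> equivalent M S T ->
  exists d : var Sg -> var Sg, renames d S T.
Proof.
move=> [_ /ex_holds_val[xiS _ hS]] [lS nS] [_ /ex_holds_val[xiT _ hT]] [_ nT] [ST TS].
have [xi' [ga [_ vga E]]] := subsumed_val ST hS.
have [xi'' [sg' [_ vsg' E']]] := subsumed_val TS hT.
set sg := vsubst _ _ in E; set ga' := vsubst _ _ in E'.
set s := ec_term S in lS nS E E' *; set t := ec_term T in nT E E' *.
have vsubstP (U : ecterm Sg) (xi : valuation M) x :
    is_val M (vsubst (ec_X U) xi x) /\ x \in ec_X U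
    \/ vsubst (ec_X U) xi x = Var x /\ x \notin ec_X U.
  case: (boolP (x \in ec_X U)) => xU; last by right; rewrite vsubst_out.
  left; split=> //; have th := ec_X_theory xU.
  by rewrite vsubst_in //; apply: valuation_is_val.
have sh : same_shape s t.
  apply: (@tsubst_same_shape _ _ sg ga ga' sg') => // x.
    by case: (vsubstP S xiS x) => -[]; [left|right].
  by case: (vsubstP T xiT x) => -[]; [left|right].
have sz := same_shape_size sh.
have vE := same_shape_vars sh E; have vE' := esym (same_shape_vars sh (esym E')).
(* [d x] is the variable of [t] facing the first occurrence of [x] in [s]. That further occurrences
   face the same variable is proved at the end. *)
pose d x := if x \in vars s then nth x (vars t) (index x (vars s)) else x.
have dE x : x \in vars s -> sg x = ga (d x).
  move=> xs; rewrite /d xs -{1}(nth_index x xs).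
  by apply: map_eq_nth vE _; rewrite index_mem.
have dE' x : x \in vars s -> ga' (d x) = sg' x.
  move=> xs; rewrite /d xs -{3}(nth_index x xs); apply/esym.
  by apply: map_eq_nth (esym vE') _; rewrite index_mem.
(* Otherwise [ga'] would fix [d x], whereas its image equals [sg' x], a value. *)
have dX : {in ec_X S, forall x, d x \in ec_X T}.
  move=> x xX; have xs := ec_X_sub xX.
  case: (vsubstP T xiT (d x)) => -[]; rewrite -/ga' dE' // vsg' //.
exists d; split=> //.
- move=> x; case: (boolP (x \in vars s)) => xs; last by rewrite /d (negPf xs).
  by rewrite -(substP ga (d x)).2 -dE // (substP sg x).2.
- by move=> x xs; rewrite /d (negPf xs).
rewrite -[RHS]tsubst_id; apply: same_shape_tsubst => //.
(* A variable is needed as default for [nth]; if [s] has none, neither has [t]. *)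
case Evs: (vars s) => [|x0 vs0].
  by case: (vars t) sz => //; rewrite Evs.
rewrite -Evs; apply: (@eq_from_nth _ (Var x0)) => [|i]; rewrite !size_map // => ilt.
rewrite !(nth_map x0) -?sz //; congr Var.
set x := nth x0 (vars s) i; set z := nth x0 (vars t) i.
have xs : x \in vars s by apply: mem_nth.
have sgz : sg x = ga z by apply: map_eq_nth vE _.
have gaz : sg' x = ga' z by apply: map_eq_nth (esym vE') _.
case: (boolP (x \in ec_X S)) => xX.
  (* By pattern-generality [x] occurs once, so its first occurrence is the one at [i]. *)
  rewrite /d xs (set_nth_default x0) ?index_nth_count ?lS // -?sz //.
(* Outside [ec_X S] the variable [x] may repeat. There [sg] fixes [x], so neither [z] nor [d x] is
   sent to a value by [ga]; both are therefore fixed by [ga'], and as both have image [sg' x] they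
   coincide. *)
have nX y : sg x = ga y -> y \notin ec_X T.
  rewrite /sg vsubst_out // => Ey; apply/negP => /vga.
  by rewrite -Ey.
have := dE' x xs; rewrite gaz /ga' !vsubst_out; first by case.
  exact: nX sgz.
exact: nX (dE x xs).
Qed.

(** The part of subsumption that concerns the constraints, once [d] has matched the terms; the bound
    variables of [T] may take any values. *)
Definition transfers (d : var Sg -> var Sg) S T :=
  forall xi : valuation M, holds xi (body (ec_constr S)) ->
  exists2 xi' : valuation M, holds xi' (body (ec_constr T))
    & {in ec_X S, forall x, xi' (d x) = xi x}.

Lemma subsumed_transfers d S T :
  renames d S T -> subsumed M S T -> transfers d S T.
Proof.
move=> [_ _ dS dX] ST xi hxi; have [xi' [ga [h' vga E]]] := subsumed_val ST hxi.
exists xi' => // x xX; move: E; rewrite -dS tsubst_comp => /tsubst_inj_in.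
move=> /(_ x (ec_X_sub xX)) /=; rewrite vga ?dX // -[LHS]/(vsubst _ _ x) vsubst_in //.
  by case.
exact: ec_X_theory xX.
Qed.

(** The composite of the two renamings fixes [ec_term S], hence each of its variables. *)
Lemma renamesK d d' S T : renames d S T -> renames d' T S ->
  {in vars (ec_term S), cancel d d'}.
Proof.
move=> [_ _ dS _] [_ _ d'T _] x xs; move: d'T; rewrite -dS tsubst_comp /=.
by rewrite -[RHS]tsubst_id => /tsubst_inj_in/(_ x xs) [].
Qed.

(** The matching substitution is [sg] after [d']. The hypotheses are weaker than [renames] so as to
    apply to reducts: there [d] may move a variable that the step has erased. *)
Lemma transfers_subsumed (xi0 : valuation M) d d' S T :
  (forall x, vsort (d' x) = vsort x) ->
  tsubst (fun x => Var (d x)) (ec_term S) = ec_term T ->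
  {in vars (ec_term S), cancel d d'} ->
  {in ec_X T, cancel d' d} -> {in ec_X T, forall y, d' y \in ec_X S} ->
  transfers d S T -> subsumed M S T.
Proof.
move=> d'sort dS dK d'K d'X tr sg vsg msg.
have [xi hxi sgX] := subst_models_val xi0 vsg msg.
have [xi' hxi' xiX] := tr xi hxi.
have gaP x : well_sorted (sg (d' x)) /\ tsort (sg (d' x)) = vsort x.
  by rewrite -d'sort; apply: substP.
have [|vga mga] := @val_subst_models _ _ xi' T (Subst gaP) hxi'.
  by move=> y yT /=; rewrite sgX ?d'X // -xiX ?d'X // d'K.
exists (Subst gaP); split=> //; rewrite -dS tsubst_comp.
by apply: eq_in_tsubst => x xs /=; rewrite dK.
Qed.

End Renaming.

(** * Redexes and reducts of a single rule *)

Section Step.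
Variables (Sg : signature) (M : model Sg) (rho : crule Sg).
Implicit Types (S T : ecterm Sg) (ga : subst Sg) (d : var Sg -> var Sg).

Lemma eval_sort (xi : valuation M) (t : term Sg) :
  well_sorted t -> theory_sort (tsort t) -> all (@theory_sym Sg) (syms t) ->
  value M (eval xi t) /\ res (eval xi t) = tsort t.
Proof.
elim/term_nested_ind: t => [x _ /(val_funP xi) //|h ts IH] /=.
case/andP=> /eqP ar ws _ /andP[th ths].
have := theory_symP th; rewrite /= -ar => /andP[_ tsts].
have {ws ths tsts} [vs rs] : all (value M) (map (eval xi) ts)
    /\ map (@res Sg) (map (eval xi) ts) = map (@tsort Sg) ts.
  elim: ts IH ws ths tsts {ar} => //= t ts IHts [IHt /IHts{}IHts].
  move=> /andP[/IHt{}IHt /IHts{}IHts]; rewrite all_cat => /andP[st /IHts{}IHts].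
  by move=> /andP[/IHt/(_ st)[-> ->] /IHts[-> ->]].
by apply: interp_sort; rewrite // -ar.
Qed.

(** [interp_and] speaks of truth values only, so each conjunct is first shown to evaluate to one,
    through its sort. *)
Lemma holds_and (xi : valuation M) (a b : term Sg) :
  logical_constraint a -> logical_constraint b ->
  holds xi (and_term a b) <-> holds xi a /\ holds xi b.
Proof.
have ev c : logical_constraint c -> exists v, eval xi c = bval M v.
  case=> ws sc th.
  have [|vc rc] := eval_sort xi ws _ th; first by rewrite sc bool_sort_theory.
  by apply: bval_surj; rewrite ?rc.
move=> /ev[v av] /ev[w bw]; rewrite /holds /= av bw interp_and.
split=> [/bval_inj/andP[-> ->] //|[/bval_inj -> /bval_inj ->] //].
Qed.

Lemma logical_and (a b : term Sg) :
  logical_constraint a -> logical_constraint b -> logical_constraint (and_term a b).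
Proof.
move=> [wa sa ta] [wb sb tb]; have [t ar r] := and_symP Sg.
by split; rewrite //= ?ar ?sa ?sb ?wa ?wb ?eqxx // t !all_cat ta tb.
Qed.

Lemma logical_tsubst ga (a : term Sg) : logical_constraint a ->
  (forall x, x \in vars a -> all (@theory_sym Sg) (syms (ga x))) ->
  logical_constraint (tsubst ga a).
Proof.
move=> [wa sa ta] gaP; split; [exact: well_sorted_tsubst|by rewrite tsort_tsubst|].
elim/term_nested_ind: a ta gaP {wa sa} => [x _|h ts IH] /=.
  by apply; rewrite inE.
case/andP=> -> /=; elim: ts IH => //= t ts IHts [IHt /IHts{}IHts].
rewrite !all_cat => /andP[/IHt{}IHt /IHts{}IHts] gaP.
by apply/andP; split; [apply: IHt|apply: IHts] => x xt; apply: gaP;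
  rewrite mem_cat xt ?orbT.
Qed.

Lemma guard_Z : {subset vars (guard rho) <= rule_Z rho}.
Proof. by move=> x xg; apply: rule_Z_sup; rewrite mem_cat xg orbT. Qed.

Lemma redex_out S p ga x :
  step_redex M rho S p ga -> x \notin vars (lhs rho) -> ga x = Var x.
Proof.
(* The domain condition yields only the double negation of the equation; inspecting [ga x] removes
   it, as equality of variables is decidable. *)
case=> dom _ _ _ xl; have := dom x; rewrite (negPf xl) /in_dom.
case: (ga x) => [y|h ts] [D _]; last by have: false by apply: D.
by congr Var; apply/eqP/negPn/negP => /eqP yx; have: false by apply: D => -[].
Qed.

Lemma redex_vars S p ga x : step_redex M rho S p ga ->
  x \in vars (lhs rho) -> {subset vars (ga x) <= vars (ec_term S)}.
Proof.
case=> _ /vars_subterm_at sub _ _ xl y yx; apply: sub.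
by apply/in_vars_tsubst; exists x.
Qed.

Lemma apart_term S x : renamed_apart rho S -> x \in rule_vars rho ->
  x \notin vars (ec_term S).
Proof. by move=> ap /ap; rewrite mem_cat negb_or => /andP[]. Qed.

Lemma apart_body S x : renamed_apart rho S -> x \in rule_vars rho ->
  x \notin vars (body (ec_constr S)).
Proof. by move=> ap /ap; rewrite mem_cat negb_or => /andP[]. Qed.

Lemma lhs_rule_vars x : x \in vars (lhs rho) -> x \in rule_vars rho.
Proof. by rewrite !mem_cat => ->. Qed.

Lemma guard_rule_vars x : x \in vars (guard rho) -> x \in rule_vars rho.
Proof. by rewrite !mem_cat => ->; rewrite !orbT. Qed.

Lemma exvars_rule_vars x : x \in rule_exvars rho -> x \in rule_vars rho.
Proof. by rewrite mem_filter !mem_cat => /andP[_ ->]; rewrite orbT. Qed.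

Lemma redex_rhs_vars S p ga x : step_redex M rho S p ga ->
  x \in vars (tsubst ga (rhs rho)) ->
  x \in vars (ec_term S) \/ x \in rule_exvars rho.
Proof.
move=> rd /in_vars_tsubst[y yr]; case: (boolP (y \in vars (lhs rho))) => yl.
  by move/(redex_vars rd yl); left.
by rewrite (redex_out rd yl) inE => /eqP ->; right; rewrite mem_filter yl.
Qed.

Lemma redex_reduct_vars S p ga x : step_redex M rho S p ga ->
  x \in vars (replace_at (ec_term S) p (tsubst ga (rhs rho))) ->
  x \in vars (ec_term S) \/ x \in rule_exvars rho.
Proof.
move=> rd /vars_replace_at; rewrite mem_cat => /orP[|]; first by left.
exact: redex_rhs_vars rd.
Qed.

Lemma redex_exvars S p ga : step_redex M rho S p ga ->
  {subset rule_exvars rho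
     <= vars (replace_at (ec_term S) p (tsubst ga (rhs rho)))}.
Proof.
move=> rd x; rewrite mem_filter => /andP[xl xr].
have [_ sub _ _] := rd; apply: (vars_replace_at_sub sub).
by apply/in_vars_tsubst; exists x; rewrite // (redex_out rd xl) inE.
Qed.

(** Guard variables belong to [rule_Z], so [ga] sends those of the left-hand side to values or
    variables; it fixes the others. *)
Lemma redex_guard_logical S p ga : step_redex M rho S p ga ->
  logical_constraint (tsubst ga (guard rho)).
Proof.
move=> rd; apply: logical_tsubst (guard_logical rho) _ => x xg.
case: (boolP (x \in vars (lhs rho))) => xl; last by rewrite (redex_out rd xl).
have [_ _ /(_ x xl (guard_Z xg)) [[v vv ->]|[y _ ->]] _] := rd => //=.
by case: (valueP vv) => ->.
Qed.

(** The reduct meets the side conditions of [ecterm]. The sort hypothesis on the extra variables is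
    there because these enter the new [ec_X], while [crule] does not bound their sorts. *)
Lemma step_result_exists S p ga :
  renamed_apart rho S -> step_redex M rho S p ga ->
  {in rule_exvars rho, forall x, theory_sort (vsort x)} ->
  exists S', step_result rho S p ga S'.
Proof.
move=> ap rd thex; have [_ sub ZX _] := rd.
pose t := replace_at (ec_term S) p (tsubst ga (rhs rho)).
pose b := and_term (body (ec_constr S)) (tsubst ga (guard rho)).
pose X := rule_exvars rho ++ [seq x <- ec_X S | x \in vars t].
have sr : tsort (tsubst ga (rhs rho)) = tsort (tsubst ga (lhs rho)).
  by rewrite !tsort_tsubst rule_sort.
have wt : well_sorted t.
  apply: well_sorted_replace_at sub sr _ (ec_term_sorted S).
  exact/well_sorted_tsubst/rhs_sorted.
have lb : logical_constraint b.
  exact: logical_and (ec_constr_logical S) (redex_guard_logical rd).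
have Xth x : x \in X -> theory_sort (vsort x).
  rewrite mem_cat mem_filter => /orP[/thex //|/andP[_]]; exact: ec_X_theory.
have bsub : {subset vdiff (vars b) (vars t) <= vars b}.
  by move=> x; rewrite mem_filter => /andP[].
(* A free variable of [b] occurs in [t]. If it stems from the old constraint or from an image under
   [ga], it lies in [ec_X S] or is extra; if it is a variable of the rule left fixed, it is apart
   from [S] and must be extra. *)
have fsub : {subset fvars (Ex (vdiff (vars b) (vars t)) b) <= X}.
  move=> x; rewrite mem_filter /= mem_filter => /andP[nx xb].
  have {nx} xt : x \in vars t by move: nx; rewrite xb andbT negbK.
  rewrite mem_cat mem_filter xt /=; apply/orP.
  move: xb; rewrite /= cats0 mem_cat => /orP[xb|].
    case: (redex_reduct_vars rd xt) => xS; last by left.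
    right; move/vars_body: xb; rewrite mem_cat => /orP[/ec_bvars_disj|//].
    by rewrite xS.
  case/in_vars_tsubst=> y yg; case: (boolP (y \in vars (lhs rho))) => yl.
    case: (ZX y yl (guard_Z yg)) => [[v _ ->] //|[z zX ->]].
    by rewrite inE => /eqP ->; right.
  rewrite (redex_out rd yl) inE => /eqP E; left; subst y.
  case: (redex_reduct_vars rd xt) => //.
  by have := apart_term ap (guard_rule_vars yg) => /negPf ->.
have Xsub : {subset X <= vars t}.
  move=> x; rewrite mem_cat mem_filter => /orP[|/andP[] //].
  exact: redex_exvars rd x.
have bdisj : vdisjoint (vdiff (vars b) (vars t)) (vars t).
  by move=> x; rewrite mem_filter => /andP[].
by exists (@ECTerm Sg X t (Ex (vdiff (vars b) (vars t)) b) wt lb bsub Xth fsub Xsub bdisj).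
Qed.

(** * Transport of a step along the renaming *)

Definition redex_transferred d ga ga' : Prop :=
  {in vars (lhs rho), forall x, ga' x = tsubst (fun y => Var (d y)) (ga x)}.

(** The new matching is [ga] followed by [d]. For the guard condition, a solution for [T] is pulled
    back to [S] along [d'], the condition is used there, and its witnesses are brought back. *)
Lemma redex_transfer d d' S T p ga :
  renamed_apart rho S -> renamed_apart rho T ->
  renames d S T -> renames d' T S -> transfers M d' T S ->
  step_redex M rho S p ga ->
  exists2 ga', step_redex M rho T p ga' & redex_transferred d ga ga'.
Proof.
move=> apS apT rST rTS tr rd; have [dsort doff dS dX] := rST.
have [_ sub ZX imp] := rd; have dK := renamesK rST rTS.
have [_ _ _ d'X] := rTS.
have dP x : well_sorted (@Var Sg (d x)) /\ tsort (@Var Sg (d x)) = vsort x by split=> //=.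
pose f x := if x \in vars (lhs rho) then tsubst (Subst dP) (ga x) else Var x.
have fP x : well_sorted (f x) /\ tsort (f x) = vsort x.
  rewrite /f; case: ifP => // _; rewrite tsort_tsubst.
  by case: (substP ga x) => w ->; split=> //; apply: well_sorted_tsubst.
have fE : {in vars (lhs rho), forall x, f x = tsubst (fun y => Var (d y)) (ga x)}.
  by move=> x xl; rewrite /f xl.
have subT : subterm_at (ec_term T) p = Some (tsubst f (lhs rho)).
  rewrite -dS (subterm_at_tsubst _ sub) tsubst_comp; congr Some.
  by apply: eq_in_tsubst => x xl; rewrite fE.
exists (Subst fP) => //; split=> //.
- move=> x; rewrite /in_dom /=; split=> [|xl fx].
    by rewrite /f; case: ifP.
  (* A variable of the left-hand side fixed by [f] would occur in the redex, hence in [T], against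
     the renaming apart. *)
  move: (apart_term apT (lhs_rule_vars xl)) => /negP; apply.
  apply: (vars_subterm_at subT); apply/in_vars_tsubst.
  by exists x; rewrite // fx inE.
- move=> x xl xZ; rewrite /= fE //.
  case: (ZX x xl xZ) => [[v vv ->]|[y yX ->]]; first by left; exists v.
  by right; exists (d y); first exact: dX.
move=> xi /ex_holds_val[xi1 xi1E h1]; have [xi2 h2 xi2E] := tr _ h1.
have hS : ex_holds xi2 (ec_constr S).
  by apply: val_ex_holds h2 => //; apply: bvars_theory.
have [xi3 /= xi3E h3] := ex_holds_val (imp _ hS).
set z := vdiff _ _ in xi3E *.
(* Only the witnesses on [z] come from [xi3]; elsewhere the given [xi] is kept. *)
apply: (@val_ex_holds _ _ _ (splice z xi xi3)) => /=.
- move=> x; rewrite mem_filter => /andP[_].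
  exact: logical_vars_theory (guard_logical rho).
- by move=> x; rewrite mem_filter /= => /andP[xz _]; apply: splice_out.
rewrite /holds -h3; apply: eval_tsubst => x xg.
case: (boolP (x \in vars (lhs rho))) => xl; last first.
  rewrite /f (negPf xl) (redex_out rd xl); apply: splice_in.
  by rewrite mem_filter xl.
rewrite fE //; case: (ZX x xl (guard_Z xg)) => [[v vv -> //]|[y yX ->]].
have ys := ec_X_sub yX.
have notz (U : ecterm Sg) w : renamed_apart rho U -> w \in vars (ec_term U) -> w \notin z.
  move=> apU wU; rewrite mem_filter negb_and; apply/orP; right.
  by apply: contraL wU => /guard_rule_vars; apply: apart_term.
have dyT := dX y yX.
have E1 : splice z xi xi3 (d y) = xi (d y).
  by apply: splice_out; apply: notz apT _; apply: ec_X_sub.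
change (splice z xi xi3 (d y) = xi3 y).
(* The values at [d y] under [xi] and [xi1] agree, equal that of [xi2] at [d' (d y)], which is [y],
   and hence that of [xi3] at [y]. *)
rewrite E1 -xi1E ?ec_X_bvars // -xi2E // dK //.
by rewrite xi3E // (notz _ _ apS).
Qed.

(** Right-hand side variables outside the left-hand side are fixed by both matchings, and by [d]
    because they do not occur in [S]. *)
Lemma step_term_renamed d S T S' T' p ga ga' :
  renamed_apart rho S -> renames d S T -> redex_transferred d ga ga' ->
  step_redex M rho S p ga -> step_redex M rho T p ga' ->
  step_result rho S p ga S' -> step_result rho T p ga' T' ->
  tsubst (fun x => Var (d x)) (ec_term S') = ec_term T'.
Proof.
move=> ap [_ doff dS _] gaE rd rd' [-> _ _ _] [-> _ _ _].
have [_ sub _ _] := rd; rewrite (replace_at_tsubst _ _ sub) dS tsubst_comp.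
congr replace_at; apply: eq_in_tsubst => x xr.
case: (boolP (x \in vars (lhs rho))) => xl; first by rewrite gaE.
rewrite (redex_out rd xl) (redex_out rd' xl) /= doff //.
by apply: apart_term => //; apply: exvars_rule_vars; rewrite mem_filter xl.
Qed.

Lemma step_transfers d S T S' T' p ga ga' :
  renamed_apart rho S -> renamed_apart rho T ->
  renames d S T -> transfers M d S T -> redex_transferred d ga ga' ->
  step_redex M rho S p ga -> step_redex M rho T p ga' ->
  step_result rho S p ga S' -> step_result rho T p ga' T' ->
  transfers M d S' T'.
Proof.
move=> apS apT [_ doff dS dX] tr gaE rd rd' [_ bS _ XS] [_ bT _ _] xi.
rewrite bS => /(holds_and _ (ec_constr_logical S) (redex_guard_logical rd))[hS hg].
have [xi2 h2 xi2E] := tr _ hS; have [_ _ ZX _] := rd.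
(* On [A] the transferred solution [xi2] is used. Rule variables avoid [A] and keep the values of
   [xi], which solve the guard. *)
set A := vars (body (ec_constr T)) ++ ec_X T.
have rule_A x : x \in rule_vars rho -> x \notin A.
  move=> xr; rewrite mem_cat negb_or apart_body //=.
  by apply: contra (apart_term apT xr); apply: ec_X_sub.
have XA x : x \in ec_X S -> splice A xi xi2 (d x) = xi x.
  by move=> xX; rewrite splice_in ?xi2E // mem_cat dX ?orbT.
exists (splice A xi xi2).
  rewrite bT; apply/(holds_and _ (ec_constr_logical T) (redex_guard_logical rd')).
  split.
    rewrite /holds -h2 -(tsubst_id (body _)); apply: eval_tsubst => x xb.
    by apply: splice_in; rewrite mem_cat xb.
  rewrite /holds -hg; apply: eval_tsubst => x xg.
  case: (boolP (x \in vars (lhs rho))) => xl; last first.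
    rewrite (redex_out rd xl) (redex_out rd' xl); apply: splice_out.
    exact/rule_A/guard_rule_vars.
  by rewrite gaE //; case: (ZX x xl (guard_Z xg)) => [[v vv -> //]|[y /XA yX ->]].
move=> x; rewrite XS mem_cat => /orP[/exvars_rule_vars xr|].
  by rewrite (doff _ (apart_term apS xr)); apply/splice_out/rule_A.
by rewrite mem_filter => /andP[_ /XA].
Qed.

(** Every variable of a reduct is either old, where the two renamings cancel, or extra, where both
    are the identity. *)
Lemma step_subsumed (xi0 : valuation M) d d' S T S' T' p ga ga' :
  renamed_apart rho S -> renamed_apart rho T ->
  renames d S T -> renames d' T S -> transfers M d S T ->
  redex_transferred d ga ga' ->
  step_redex M rho S p ga -> step_redex M rho T p ga' ->
  step_result rho S p ga S' -> step_result rho T p ga' T' ->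
  redex_transferred d' ga' ga -> subsumed M S' T'.
Proof.
move=> apS apT rST rTS tr gaE rd rd' stS stT gaE'.
have [_ doff _ _] := rST; have [d'sort d'off _ d'X] := rTS.
have tS := step_term_renamed apS rST gaE rd rd' stS stT.
have tT := step_term_renamed apT rTS gaE' rd' rd stT stS.
have dE x : x \in rule_exvars rho -> d x = x.
  by move/exvars_rule_vars => xr; apply/doff/apart_term.
have d'E x : x \in rule_exvars rho -> d' x = x.
  by move/exvars_rule_vars => xr; apply/d'off/apart_term.
have [eS _ _ XS] := stS; have [eT _ _ XT] := stT.
apply: transfers_subsumed tS _ _ _ _ => //.
- move=> x; rewrite eS => /(redex_reduct_vars rd)[|xe].
    exact: renamesK rST rTS x.
  by rewrite dE // d'E.
- move=> x /ec_X_sub; rewrite eT => /(redex_reduct_vars rd')[|xe].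
    exact: renamesK rTS rST x.
  by rewrite d'E // dE.
- move=> y; rewrite XT XS !mem_cat => /orP[ye|]; first by rewrite d'E // ye.
  rewrite mem_filter => /andP[yt yX]; apply/orP; right.
  rewrite mem_filter d'X // -tT andbT.
  by apply/in_vars_tsubst; exists y; rewrite // inE.
exact: step_transfers apS apT rST tr gaE rd rd' stS stT.
Qed.

End Step.

Theorem mainTheorem5 (Sg : signature) (M : model Sg) (rho : crule Sg)
    (S T S' : ecterm Sg) :
  left_linear rho ->
  satisfiable M S -> pattern_general M S ->
  satisfiable M T -> pattern_general M T ->
  renamed_apart rho T ->
  most_general_step M rho S S' ->
  equivalent M S T ->
  exists T' : ecterm Sg,
    most_general_step M rho T T' /\ equivalent M S' T'.
Proof.
move=> ll sS pS sT pT apT [_ _ apS [p [ga [rd stS]]]] eqST.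
have eqTS : equivalent M T S by case: eqST.
have [d rST] := equivalent_renaming sS pS sT pT eqST.
have [d' rTS] := equivalent_renaming sT pT sS pS eqTS.
have trST := subsumed_transfers rST eqST.1.
have trTS := subsumed_transfers rTS eqST.2.
have [ga' rd' gaE] := redex_transfer apS apT rST rTS trTS rd.
(* The images under [ga] contain only variables of [S], on which [d'] undoes [d]; this makes the
   situation symmetric in [S] and [T]. *)
have gaE' : redex_transferred rho d' ga' ga.
  move=> x xl; rewrite gaE // tsubst_comp -[LHS]tsubst_id.
  apply: eq_in_tsubst => y yx /=.
  by rewrite (renamesK rST rTS) // (redex_vars rd xl).
have [|T' stT] := step_result_exists apT rd'.
  (* The given reduct [S'] is well formed and has the same extra variables, so they are of theory
     sort. *)
  move=> x xe; have [_ _ _ XS] := stS.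
  by apply: (ec_X_theory (e := S')); rewrite XS mem_cat xe.
have [xi0 _] := sS.
exists T'; split; first by split=> //; exists p, ga'.
split; [exact: (step_subsumed xi0 apS apT rST rTS trST gaE rd rd' stS stT gaE')|].
exact: (step_subsumed xi0 apT apS rTS rST trTS gaE' rd' rd stT stS gaE).
Qed.
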